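(* Let $P$ be a 0-1 matrix with at least one and at most four $1$ entries. Then $\operatorname{sat}(n,P)=O(1)$ if and only if $P$ is the $1\times1$ matrix $\begin{pmatrix}1\end{pmatrix}$ or $P$ is $Q_1$-like.
   Context: A matrix $M$ contains $P$ if some submatrix of $M$ (obtained by deleting rows and columns) can be turned into $P$ by changing some number (possibly zero) of its ones to zeroes. The weight is the number of $1$ entries. $M$ is $P$-saturated if $M$ does not contain $P$, but changing any $0$ entry of $M$ to a $1$ yields a matrix containing $P$. $\operatorname{sat}(n,P)$ is the minimum weight of an $n\times n$ $P$-saturated matrix; asymptotics are for $n\to\infty$. A pattern $P$ is called $Q_1$-like if all of the following hold. (1) $P$ contains exactly one $1$ entry in each of its top row, bottom row, first column, and last column, called $t$, $b$, $l$, $r$ respectively, and these four entries are distinct. (2) $t$ and $b$ are the only $1$ entries in their respective columns, and $l$ and $r$ are the only $1$ entries in their respective rows. (3) Either $t$ is left of $b$ and $r$ is above $l$, or $t$ is right of $b$ and $r$ is below $l$. *)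

(* Defs.v *)
From mathcomp Require Import all_boot all_algebra.
Set Implicit Arguments.
Unset Strict Implicit.
Unset Printing Implicit Defensive.

(* 0-1 matrices are boolean matrices, [true] standing for a 1 entry.  Rows are
   numbered from top to bottom and columns from left to right. *)

Definition ones m n (M : 'M[bool]_(m, n)) : {set 'I_m * 'I_n} :=
  [set x | M x.1 x.2].

Definition weight m n (M : 'M[bool]_(m, n)) : nat := #|ones M|.

Definition increasing k m (f : {ffun 'I_k -> 'I_m}) : bool :=
  [forall i : 'I_k, forall j : 'I_k, (i < j) ==> (f i < f j)].

(* [mxsub f g M], for increasing [f] and [g], is the submatrix of [M] obtained
   by deleting the rows outside the range of [f] and the columns outside the
   range of [g]. *)
Definition contains m n k l (M : 'M[bool]_(m, n)) (P : 'M[bool]_(k, l)) : bool :=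
  [exists f : {ffun 'I_k -> 'I_m}, exists g : {ffun 'I_l -> 'I_n},
    [&& increasing f, increasing g & ones P \subset ones (mxsub f g M)]].

Definition set_one m n (M : 'M[bool]_(m, n)) (i : 'I_m) (j : 'I_n) :
    'M[bool]_(m, n) :=
  \matrix_(i', j') (((i', j') == (i, j)) || M i' j').

Definition saturated m n k l (P : 'M[bool]_(k, l)) (M : 'M[bool]_(m, n)) : bool :=
  ~~ contains M P &&
  [forall i, forall j, ~~ M i j ==> contains (set_one M i j) P].

(* The default value n * n bounds every weight from above, so it does not
   affect the minimum; see [satP]. *)
Definition sat n k l (P : 'M[bool]_(k, l)) : nat :=
  \big[minn/n * n]_(M : 'M[bool]_n | saturated P M) weight M.

Lemma saturated_exists n k l (P : 'M[bool]_(k, l)) :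
  0 < weight P -> exists M : 'M[bool]_n, saturated P M.
Proof.
case/card_gt0P=> -[i0 j0]; rewrite inE /= => Pij.
pose avoids (M : 'M[bool]_n) := ~~ contains M P.
have avoids0 : avoids (const_mx false).
  apply/existsP=> -[f /existsP[g /and3P[_ _ /subsetP/(_ (i0, j0))]]].
  by rewrite !inE !mxE /= => /(_ Pij).
case: (@arg_maxnP _ (const_mx false) avoids (@weight n n) avoids0) => M MP maxM.
exists M; apply/andP; split=> //.
apply/forallP=> i; apply/forallP=> j; apply/implyP=> Mij.
apply: contraT => /maxM /=; rewrite leqNgt => /negP[].
apply/proper_card/properP; split.
  by apply/subsetP=> x; rewrite !inE !mxE => ->; rewrite orbT.
by exists (i, j); rewrite !inE ?mxE ?eqxx.
Qed.

Lemma satP n k l (P : 'M[bool]_(k, l)) : 0 < weight P ->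
  (exists2 M : 'M[bool]_n, saturated P M & weight M = sat n P) /\
  (forall M : 'M[bool]_n, saturated P M -> sat n P <= weight M).
Proof.
move=> P0; have le_sat (M : 'M[bool]_n) : saturated P M -> sat n P <= weight M.
  move=> sM; rewrite /sat; have := mem_index_enum M.
  elim: (index_enum _) => // A s IH; rewrite inE big_cons.
  case/orP=> [/eqP<- | /IH le_s]; first by rewrite sM geq_minl.
  by case: ifP => // _; rewrite (leq_trans (geq_minr _ _)).
split=> //; have [M0 sM0] := saturated_exists n P0.
have : sat n P = n * n \/
    exists2 M : 'M[bool]_n, saturated P M & weight M = sat n P.
  rewrite /sat; elim/big_rec: _ => [|M x sM IH]; first by left.
  case: (leqP (weight M) x) => [lexM|ltxM]; first by right; exists M.
  exact: IH.
case=> // satE; exists M0 => //; apply/eqP; rewrite eqn_leq le_sat // andbT satE.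
by rewrite (leq_trans (max_card _)) // card_prod card_ord.
Qed.

Definition bigO1 (u : nat -> nat) : Prop :=
  exists C N : nat, forall n : nat, N <= n -> u n <= C.

(* An entry is a pair (row, column). *)
Definition on_row m n (i : nat) : {set 'I_m * 'I_n} :=
  [set x : 'I_m * 'I_n | x.1 == i :> nat].

Definition on_col m n (j : nat) : {set 'I_m * 'I_n} :=
  [set x : 'I_m * 'I_n | x.2 == j :> nat].

Definition only_one_in m n (P : 'M[bool]_(m, n)) (A : {set 'I_m * 'I_n})
  (x : 'I_m * 'I_n) : Prop := ones P :&: A = [set x].

Definition Q1_like m n (P : 'M[bool]_(m, n)) : Prop :=
  exists t b l r : 'I_m * 'I_n,
    [/\ [/\ only_one_in P (on_row m n 0) t,
            only_one_in P (on_row m n m.-1) b,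
            only_one_in P (on_col m n 0) l,
            only_one_in P (on_col m n n.-1) r
          & uniq [:: t; b; l; r]],
        [/\ only_one_in P (on_col m n t.2) t,
            only_one_in P (on_col m n b.2) b,
            only_one_in P (on_row m n l.1) l
          & only_one_in P (on_row m n r.1) r]
      & (t.2 < b.2 /\ r.1 < l.1) \/ (b.2 < t.2 /\ l.1 < r.1)].

(* Main.v *)
Require Import Defs.
From mathcomp Require Import all_boot all_algebra zify.
Set Implicit Arguments.
Unset Strict Implicit.
Unset Printing Implicit Defensive.

(** Bounded saturation forces the Q1 shape.  If [sat n P] is bounded, then for
    large [n] some saturated [M] has an empty row and an empty column.  A 1
    added to the first place of the empty row has to play the part of a 1 of
    the first column of [P] which is alone in its row; the last place and the
    empty column give the same on the other three sides.  Hence [P] has an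
    entry [l] in its first column and [r] in its last column, each alone in its
    row, and an entry [t] in its top row and [b] in its bottom row, each alone
    in its column.  Moreover a pattern that splits into two diagonal (or
    antidiagonal) blocks has no saturated matrix with an empty row
    ([block_diagonal_no_empty_row]): along the row, the added 1 is first used
    by the left block and finally by the right block, and two neighbouring
    places where the use changes show the two blocks side by side in [M].
    If [P] has one column, then [t] and [b] coincide and [P] is the 1 by 1
    matrix.  Otherwise, with at most four ones, if two of [t], [b], [l], [r]
    coincide they sit in an isolated corner and [P] splits; if all four are
    distinct they are all the ones of [P], and the orders of [t], [b] and of
    [l], [r] that are not Q1-like are exactly those where [P] splits
    ([isolated_sides_Q1_like_or_decomposable]).

    Conversely, a Q1-like pattern with four ones is, up to a mirror image, the
    permutation matrix
<<
      . t . .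
      . . . r
      l . . .
      . . b .
>>
    with empty rows and columns inserted inside.  Consider
<<
      . . . * . .
      . * . . . *
      - - - - - -
      * . . . * .
      . . * . . .
>>
    It avoids Q1.  A 1 added to the dashed row can play [l] when it lies to the
    left of the 1 of the top row, and [r] when it lies to the right of the 1 of
    the bottom row, so every place of that row completes a Q1, also when the
    row is prolonged on either side.  Rotating this matrix gives one with an
    empty column of the same kind.  As Q1 does not split into blocks, the
    diagonal sum of both still avoids Q1.  Spreading its rows and columns apart
    makes room for the empty rows and columns of [P], and repeating the dashed
    row and column fills an [n] by [n] matrix where a new 1 completes [P]
    except in boundedly many rows crossing boundedly many columns.  A saturated
    matrix above this one has all its ones in these crossings
    ([sat_le_square]). *)

(** * Containment and increasing maps *)
Definition strictly_increasing k m (f : 'I_k -> 'I_m) :=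
  forall i j : 'I_k, i < j -> f i < f j.

Lemma containsP m n k l (M : 'M[bool]_(m, n)) (P : 'M[bool]_(k, l)) :
  reflect (exists f g, [/\ strictly_increasing f, strictly_increasing g
                         & forall i j, P i j -> M (f i) (g j)])
          (contains M P).
Proof.
apply: (iffP existsP) => [[f /existsP[g /and3P[incf incg /subsetP sPM]]]|].
  exists f, g; split=> [i j ltij|i j ltij|i j Pij].
  - by have /forallP/(_ i)/forallP/(_ j)/implyP := incf; apply.
  - by have /forallP/(_ i)/forallP/(_ j)/implyP := incg; apply.
  - by have := sPM (i, j); rewrite !inE mxE; apply.
case=> f [g [incf incg sPM]]; exists (finfun f); apply/existsP; exists (finfun g).
apply/and3P; split.
- by apply/forallP=> i; apply/forallP=> j; apply/implyP; rewrite !ffunE; apply: incf.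
- by apply/forallP=> i; apply/forallP=> j; apply/implyP; rewrite !ffunE; apply: incg.
- by apply/subsetP=> -[i j]; rewrite !inE mxE !ffunE; apply: sPM.
Qed.

Lemma set_oneE m n (M : 'M[bool]_(m, n)) i j i' j' :
  set_one M i j i' j' = ((i', j') == (i, j)) || M i' j'.
Proof. by rewrite mxE. Qed.

Lemma strictly_increasing_inj k m (f : 'I_k -> 'I_m) :
  strictly_increasing f -> injective f.
Proof.
move=> incf i j eqf; apply: val_inj => /=.
case: (ltngtP i j) => // /incf; by rewrite eqf ltnn.
Qed.

Lemma strictly_increasing_ge k m (f : 'I_k -> 'I_m) (i : 'I_k) :
  strictly_increasing f -> i <= f i.
Proof.
move=> incf; case: i => i; elim: i => //= i IH ltik.
by apply: leq_ltn_trans (IH (ltnW ltik)) _; apply: incf => /=.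
Qed.

Lemma strictly_increasing_rev k m (f : 'I_k -> 'I_m) :
  strictly_increasing f -> strictly_increasing (fun i => rev_ord (f (rev_ord i))).
Proof.
move=> incf i j ltij /=.
have : f (rev_ord j) < f (rev_ord i) by apply: incf => /=; have := ltn_ord j; lia.
by have := ltn_ord (f (rev_ord i)); lia.
Qed.

(** The mirror image of [strictly_increasing_ge]: an increasing map that reaches
    the last index does so at its last argument. *)
Lemma strictly_increasing_last k m (f : 'I_k -> 'I_m) (i : 'I_k) :
  strictly_increasing f -> f i = m.-1 :> nat -> i = k.-1 :> nat.
Proof.
move=> /strictly_increasing_rev/(@strictly_increasing_ge _ _ _ (rev_ord i)).
rewrite rev_ordK /= => le_rev fi.
by have := ltn_ord i; have := ltn_ord (f i); lia.
Qed.

(** * Symmetries *)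

Definition mirror m n (M : 'M[bool]_(m, n)) : 'M[bool]_(m, n) :=
  \matrix_(i, j) M i (rev_ord j).

Lemma mirrorE m n (M : 'M[bool]_(m, n)) i j : mirror M i j = M i (rev_ord j).
Proof. by rewrite mxE. Qed.

Lemma mirrorK m n : involutive (@mirror m n).
Proof. by move=> M; apply/matrixP=> i j; rewrite !mirrorE rev_ordK. Qed.

Lemma mirror_set_one m n (M : 'M[bool]_(m, n)) i j :
  mirror (set_one M i j) = set_one (mirror M) i (rev_ord j).
Proof.
apply/matrixP=> i' j'; rewrite mirrorE !set_oneE mirrorE !xpair_eqE.
by rewrite -(inj_eq rev_ord_inj j') rev_ordK.
Qed.

Lemma weight_mirror m n (M : 'M[bool]_(m, n)) : weight (mirror M) = weight M.
Proof.
pose h (x : 'I_m * 'I_n) := (x.1, rev_ord x.2).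
have hK : cancel h h by case=> i j; rewrite /h rev_ordK.
rewrite /weight -(card_imset (ones M) (can_inj hK)); apply: eq_card => x.
by rewrite (can2_imset_pre (ones M) hK hK) !inE mirrorE.
Qed.

Lemma contains_mirror m n k l (M : 'M[bool]_(m, n)) (P : 'M[bool]_(k, l)) :
  contains (mirror M) (mirror P) = contains M P.
Proof.
have half (A : 'M[bool]_(m, n)) (B : 'M[bool]_(k, l)) :
    contains A B -> contains (mirror A) (mirror B).
  case/containsP=> f [g [incf incg sBA]]; apply/containsP.
  exists f, (fun j => rev_ord (g (rev_ord j))).
  split=> // [|i j]; first exact: strictly_increasing_rev.
  by rewrite !mirrorE rev_ordK; apply: sBA.
by apply/idP/idP=> /half //; rewrite !mirrorK.
Qed.

Lemma saturated_mirror m n k l (P : 'M[bool]_(k, l)) (M : 'M[bool]_(m, n)) :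
  saturated P M -> saturated (mirror P) (mirror M).
Proof.
case/andP=> avoidM fullM; rewrite /saturated contains_mirror avoidM /=.
apply/forallP=> i; apply/forallP=> j; apply/implyP; rewrite mirrorE => Mij.
rewrite -(rev_ordK j) -mirror_set_one contains_mirror.
by have /forallP/(_ i)/forallP/(_ (rev_ord j))/implyP := fullM; apply.
Qed.

Lemma trmx_set_one m n (M : 'M[bool]_(m, n)) i j :
  trmx (set_one M i j) = set_one (trmx M) j i.
Proof.
by apply/matrixP=> i' j'; rewrite [LHS]mxE !set_oneE mxE !xpair_eqE andbC.
Qed.

Lemma weight_trmx m n (M : 'M[bool]_(m, n)) : weight (trmx M) = weight M.
Proof.
pose h p q (x : 'I_p * 'I_q) := (x.2, x.1).
have hK p q : cancel (@h p q) (@h q p) by case.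
rewrite /weight -(card_imset (ones M) (can_inj (hK _ _))); apply: eq_card => x.
by rewrite (can2_imset_pre (ones M) (hK _ _) (hK _ _)) !inE mxE.
Qed.

Lemma contains_trmx m n k l (M : 'M[bool]_(m, n)) (P : 'M[bool]_(k, l)) :
  contains (trmx M) (trmx P) = contains M P.
Proof.
have half m' n' k' l' (A : 'M[bool]_(m', n')) (B : 'M[bool]_(k', l')) :
    contains A B -> contains (trmx A) (trmx B).
  case/containsP=> f [g [incf incg sBA]]; apply/containsP.
  by exists g, f; split=> // i j; rewrite !mxE; apply: sBA.
by apply/idP/idP=> /half //; rewrite !trmxK.
Qed.

Lemma saturated_trmx m n k l (P : 'M[bool]_(k, l)) (M : 'M[bool]_(m, n)) :
  saturated P M -> saturated (trmx P) (trmx M).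
Proof.
case/andP=> avoidM fullM; rewrite /saturated contains_trmx avoidM /=.
apply/forallP=> i; apply/forallP=> j; apply/implyP; rewrite mxE => Mji.
rewrite -trmx_set_one contains_trmx.
by have /forallP/(_ j)/forallP/(_ i)/implyP := fullM; apply.
Qed.

(** A minimal saturated matrix of one pattern is reflected into a saturated
    matrix of the other. *)
Lemma leq_sat_mirror n k l (P : 'M[bool]_(k, l)) :
  0 < weight P -> sat n P <= sat n (mirror P).
Proof.
move=> P0; have [_ le_sat] := satP n P0.
have [|[M /saturated_mirror satM <-] _] := @satP n _ _ (mirror P).
  by rewrite weight_mirror.
by rewrite -(weight_mirror M) le_sat // -(mirrorK P).
Qed.

(** * Empty rows of a saturated matrix *)

Definition empty_row m n (M : 'M[bool]_(m, n)) (i : 'I_m) :=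
  forall j, ~~ M i j.

(** Choosing the row of each 1 maps the ones onto the nonempty rows. *)
Lemma light_empty_row m n (M : 'M[bool]_(m, n)) :
  weight M < m -> exists i, empty_row M i.
Proof.
move=> ltMm; suff /existsP[i /forallP Mi] : [exists i, forall j, ~~ M i j].
  by exists i.
apply: contraLR ltMm; rewrite negb_exists -leqNgt => /forallP fullM.
rewrite -[X in X <= _]card_ord; apply: leq_trans (leq_imset_card fst (ones M)).
apply/subset_leq_card/subsetP=> i _; have := fullM i.
rewrite negb_forall => /existsP[j]; rewrite negbK => Mij.
by apply/imsetP; exists (i, j); rewrite ?inE.
Qed.

Definition row_isolated k l (P : 'M[bool]_(k, l)) a b :=
  P a b /\ forall b', P a b' -> b' = b.

(** The copy [f], [g] of [P] uses the place [(i, j)] through the entry [(a, b)]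
    and finds the other rows of [P] in [M].  When row [i] of [M] is empty, the
    entry [(a, b)] has to be alone in its row. *)
Definition completes m n k l (P : 'M[bool]_(k, l)) (M : 'M[bool]_(m, n)) i j
    (f : 'I_k -> 'I_m) (g : 'I_l -> 'I_n) (a : 'I_k) (b : 'I_l) :=
  [/\ strictly_increasing f, strictly_increasing g, f a = i /\ g b = j,
      row_isolated P a b
    & forall a' b', P a' b' -> a' != a -> M (f a') (g b')].

(** A copy of [P] that does not use the added 1 would already lie in [M]. *)
Lemma empty_row_completes m n k l (P : 'M[bool]_(k, l)) (M : 'M[bool]_(m, n)) i :
  saturated P M -> empty_row M i -> forall j, exists f g a b, completes P M i j f g a b.
Proof.
case/andP=> avoidM fullM Mi j.
have /containsP[f [g [incf incg sPM]]] : contains (set_one M i j) P.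
  by have /forallP/(_ i)/forallP/(_ j)/implyP := fullM; apply; apply: Mi.
have [/existsP[a /existsP[b /andP[Pab /eqP[fa gb]]]]|] :=
    boolP [exists a, exists b, P a b && ((f a, g b) == (i, j))].
  exists f, g, a, b; split=> //; first split=> // b' Pab'.
    have := sPM _ _ Pab'; rewrite fa set_oneE (negbTE (Mi _)) orbF xpair_eqE => /andP[_ /eqP].
    by rewrite -gb => /(strictly_increasing_inj incg).
  move=> a' b' Pab' neq_a; have := sPM _ _ Pab'; rewrite set_oneE xpair_eqE -fa.
  by rewrite (inj_eq (strictly_increasing_inj incf)) (negbTE neq_a).
rewrite negb_exists => /forallP noab; case/negP: avoidM; apply/containsP.
exists f, g; split=> // a b Pab; have := sPM _ _ Pab; rewrite set_oneE.
have := noab a; rewrite negb_exists => /forallP/(_ b); rewrite Pab /=.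
by move/negbTE->.
Qed.

(** The 1 added in the first column of [M] can only play an entry of the first
    column of [P], because increasing maps do not decrease indices. *)
Lemma empty_row_isolated_first m n k l (P : 'M[bool]_(k, l)) (M : 'M[bool]_(m, n)) i :
  0 < n -> saturated P M -> empty_row M i ->
  exists a (b : 'I_l), b = 0 :> nat /\ row_isolated P a b.
Proof.
move=> n_gt0 satM Mi.
have [f [g [a [b [_ incg [_ gb] Pab _]]]]] := empty_row_completes satM Mi (Ordinal n_gt0).
exists a, b; split=> //; apply/eqP; rewrite -leqn0.
by apply: leq_trans (strictly_increasing_ge b incg) _; rewrite gb.
Qed.

Lemma row_isolated_mirror k l (P : 'M[bool]_(k, l)) a b :
  row_isolated (mirror P) a b -> row_isolated P a (rev_ord b).
Proof.
case=> Pab uniqb; rewrite mirrorE in Pab; split=> // b' Pab'.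
by apply: rev_ord_inj; rewrite rev_ordK; apply: uniqb; rewrite mirrorE rev_ordK.
Qed.

Lemma empty_row_mirror m n (M : 'M[bool]_(m, n)) i :
  empty_row M i -> empty_row (mirror M) i.
Proof. by move=> Mi j; rewrite mirrorE. Qed.

Lemma empty_row_isolated_last m n k l (P : 'M[bool]_(k, l)) (M : 'M[bool]_(m, n)) i :
  0 < n -> saturated P M -> empty_row M i ->
  exists a (b : 'I_l), b = l.-1 :> nat /\ row_isolated P a b.
Proof.
move=> n_gt0 /saturated_mirror satM /empty_row_mirror Mi.
have [a [b [b0 /row_isolated_mirror Pab]]] := empty_row_isolated_first n_gt0 satM Mi.
by exists a, (rev_ord b); split=> //=; rewrite b0 subn1.
Qed.

(** All ones lie in the upper left [r] by [c] block or in the complementary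
    lower right block. *)
Definition block_diagonal k l (P : 'M[bool]_(k, l)) (r c : nat) :=
  forall a b, P a b -> (a < r) = (b < c).

(** Scan the empty row [i] from left to right.  By induction, at each place the
    added 1 is always used by the upper left block: otherwise the copy at [j]
    has its lower right block below [i] and right of [j], the copy at [j.+1]
    has its upper left block above [i] and at most at column [j], and together
    they form a copy of [P] in [M].  At the last place the added 1 is in the
    last column of [P], which belongs to the other block. *)
Lemma block_diagonal_no_empty_row m n k l (P : 'M[bool]_(k, l)) (M : 'M[bool]_(m, n)) r c i :
  0 < n -> 0 < c < l -> block_diagonal P r c -> saturated P M -> ~ empty_row M i.
Proof.
move=> n_gt0 /andP[c_gt0 ltcl] blockP satM Mi.
have all_left : forall j (ltjn : j < n) f g a b,
    completes P M i (Ordinal ltjn) f g a b -> b < c.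
  elim=> [|j IH] ltjn f2 g2 a2 b2 comp2.
    case: comp2 => _ incg [_ gb] _ _.
    apply: leq_ltn_trans c_gt0.
    by apply: leq_trans (strictly_increasing_ge b2 incg) _; rewrite gb.
  (* The left block is taken from copy 2 and the right block from copy 1. *)
  have [f1 [g1 [a1 [b1 comp1]]]] := empty_row_completes satM Mi (Ordinal (ltnW ltjn)).
  have ltb1 := IH _ _ _ _ _ comp1; rewrite ltnNge; apply/negP=> leb2.
  case: comp1 comp2 => incf1 incg1 [fa1 gb1] [Pab1 _] P1 [incf2 incg2 [fa2 gb2] [Pab2 _] P2].
  have lta1 : a1 < r by rewrite (blockP _ _ Pab1).
  have lea2 : r <= a2 by rewrite leqNgt (blockP _ _ Pab2) -leqNgt.
  have f2_lt (a : 'I_k) : a < r -> f2 a < i.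
    by move=> lta; rewrite -fa2; apply: incf2; apply: leq_trans lea2.
  have f1_gt (a : 'I_k) : r <= a -> i < f1 a.
    by move=> lea; rewrite -fa1; apply: incf1; apply: leq_trans lea.
  have g2_le (b : 'I_l) : b < c -> g2 b <= j.
    by move=> ltb; have /incg2 : b < b2 by [apply: leq_trans leb2]; rewrite gb2.
  have g1_gt (b : 'I_l) : c <= b -> j < g1 b.
    by move=> leb; have /incg1 : b1 < b by [apply: leq_trans leb]; rewrite gb1.
  case/andP: satM => /negP[]; apply/containsP.
  exists (fun a : 'I_k => if a < r then f2 a else f1 a),
         (fun b : 'I_l => if b < c then g2 b else g1 b).
  split=> [a a' lta|b b' ltb|a b Pab] /=.
  - case: (ltnP a r) => la; case: (ltnP a' r) => la'; [exact: incf2 | | lia | exact: incf1].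
    exact: ltn_trans (f2_lt _ la) (f1_gt _ la').
  - case: (ltnP b c) => lb; case: (ltnP b' c) => lb'; [exact: incg2 | | lia | exact: incg1].
    exact: leq_ltn_trans (g2_le _ lb) (g1_gt _ lb').
  - rewrite -(blockP _ _ Pab); case: ltnP => la.
      by apply: P2 => //; apply: contraTneq la => ->; rewrite -leqNgt.
    by apply: P1 => //; apply: contraTneq la => ->; rewrite -ltnNge.
have lt_last : n.-1 < n by rewrite prednK.
have [f [g [a [b comp]]]] := empty_row_completes satM Mi (Ordinal lt_last).
have := all_left _ _ _ _ _ _ comp; case: comp => _ incg [_ gb] _ _.
have -> : b = l.-1 :> nat by apply: (strictly_increasing_last incg); rewrite gb.
by lia.
Qed.

(** The ones are in the upper right or in the lower left block, so the mirror
    image is block diagonal. *)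
Definition anti_block_diagonal k l (P : 'M[bool]_(k, l)) (r c : nat) :=
  forall a b, P a b -> (a < r) = (c <= b).

Lemma anti_block_diagonal_no_empty_row m n k l (P : 'M[bool]_(k, l))
    (M : 'M[bool]_(m, n)) r c i :
  0 < n -> 0 < c < l -> anti_block_diagonal P r c -> saturated P M -> ~ empty_row M i.
Proof.
move=> n_gt0 ltcl antiP /saturated_mirror satM /empty_row_mirror.
apply: (@block_diagonal_no_empty_row _ _ _ _ _ _ r (l - c)) satM => //; first by lia.
move=> a b; rewrite mirrorE => /antiP ->; rewrite /=.
by have := ltn_ord b; lia.
Qed.

(** * Patterns with bounded saturation function *)

Lemma bounded_sat_sparse k l (P : 'M[bool]_(k, l)) :
  0 < weight P -> bigO1 (fun n => sat n P) ->
  exists n, exists M : 'M[bool]_n, [/\ 0 < n, saturated P M,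
    exists i, empty_row M i & exists j, empty_row (trmx M) j].
Proof.
move=> P0 [C [N leC]]; set n := maxn N C.+1.
have [[M satM wM] _] := satP n P0; exists n, M.
have ltMn : weight M < n by rewrite wM (leq_ltn_trans (leC n _)) ?leq_max ?leqnn ?orbT.
split=> //; first by rewrite leq_max orbT.
  exact: light_empty_row.
by apply: light_empty_row; rewrite weight_trmx.
Qed.

Lemma only_one_inP m n (P : 'M[bool]_(m, n)) A x :
  only_one_in P A x <->
  [/\ P x.1 x.2, x \in A & forall y, P y.1 y.2 -> y \in A -> y = x].
Proof.
split=> [eqA | [Px xA uniqx]].
  have inA y : (P y.1 y.2 && (y \in A)) = (y == x).
    by have /setP/(_ y) := eqA; rewrite !inE.
  have /andP[Px xA] : P x.1 x.2 && (x \in A) by rewrite inA.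
  by split=> // y Py yA; apply/eqP; rewrite -inA Py.
apply/setP=> y; rewrite !inE; apply/andP/eqP => [[Py yA] | -> //].
exact: uniqx.
Qed.

(** As many distinct ones as the weight allows are all the ones of [P]. *)
Lemma ones_of_weight_le_size k l (P : 'M[bool]_(k, l)) (s : seq ('I_k * 'I_l)) :
  weight P <= size s -> uniq s -> {in s, forall x, P x.1 x.2} ->
  forall x, P x.1 x.2 -> x \in s.
Proof.
move=> leP uniqs sP x Px.
have sub : [set y in s] \subset ones P by apply/subsetP=> y; rewrite !inE => /sP.
have card_s : #|[set y in s]| = size s by rewrite cardsE; apply/card_uniqP.
have : [set y in s] == ones P by rewrite eqEcard sub card_s.
by move/eqP/setP/(_ x); rewrite !inE Px.
Qed.

Lemma ord_lt_last k (a : 'I_k) : (a < k.-1) = (a != k.-1 :> nat).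
Proof. by have := ltn_ord a; lia. Qed.

Lemma ord_ge1 k (a : 'I_k) : (1 <= a) = (a != 0 :> nat).
Proof. by rewrite lt0n. Qed.

Definition col_isolated k l (P : 'M[bool]_(k, l)) a b :=
  P a b /\ forall a', P a' b -> a' = a.

Lemma row_isolated_trmx k l (P : 'M[bool]_(k, l)) a b :
  row_isolated (trmx P) b a -> col_isolated P a b.
Proof.
by case=> Pab uniqa; rewrite mxE in Pab; split=> // a' Pa'b; apply: uniqa; rewrite mxE.
Qed.

Lemma row_isolatedE k l (P : 'M[bool]_(k, l)) a b x :
  row_isolated P a b -> P x.1 x.2 -> x.1 = a :> nat -> x = (a, b).
Proof.
by case: x => a' b' [_ uniqb] /= Pab /val_inj eqa; rewrite -(uniqb b') -eqa.
Qed.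

Lemma col_isolatedE k l (P : 'M[bool]_(k, l)) a b x :
  col_isolated P a b -> P x.1 x.2 -> x.2 = b :> nat -> x = (a, b).
Proof.
by case: x => a' b' [_ uniqa] /= Pab /val_inj eqb; rewrite -(uniqa a') -eqb.
Qed.

Lemma isolated_corner k l (P : 'M[bool]_(k, l)) a0 b0 :
  row_isolated P a0 b0 -> col_isolated P a0 b0 ->
  forall a b, P a b -> (a == a0 :> nat) = (b == b0 :> nat).
Proof.
move=> rowP colP a b Pab; apply/eqP/eqP => eq0.
  by have [_ ->] := row_isolatedE rowP (Pab : P (a, b).1 (a, b).2) eq0.
by have [-> _] := col_isolatedE colP (Pab : P (a, b).1 (a, b).2) eq0.
Qed.

Definition decomposable k l (P : 'M[bool]_(k, l)) := exists r c,
  0 < c < l /\ (block_diagonal P r c \/ anti_block_diagonal P r c).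

(** A corner entry that is alone in its row and in its column is a block by
    itself. *)
Lemma isolated_corner_decomposable k l (P : 'M[bool]_(k, l)) (a : 'I_k) (b : 'I_l) :
  1 < l -> (a == 0 :> nat) || (a == k.-1 :> nat) ->
  (b == 0 :> nat) || (b == l.-1 :> nat) ->
  row_isolated P a b -> col_isolated P a b -> decomposable P.
Proof.
move=> l_gt1 /orP[]/eqP a0 /orP[]/eqP b0 rowP /(isolated_corner rowP) cornerP.
- exists 1, 1; split=> //; left=> a' b' /cornerP; rewrite a0 b0.
  by rewrite !ltnS !leqn0.
- exists 1, l.-1; split; [by lia | right=> a' b' /cornerP; rewrite a0 b0].
  by rewrite ltnS leqn0 leqNgt ord_lt_last negbK.
- exists k.-1, 1; split=> //; right=> a' b' /cornerP; rewrite a0 b0.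
  by rewrite ord_lt_last ord_ge1 => ->.
- exists k.-1, l.-1; split; [by lia | left=> a' b' /cornerP; rewrite a0 b0].
  by rewrite !ord_lt_last => ->.
Qed.

(** Two of the four entries can only coincide in a corner, which splits off.
    Otherwise they are all the ones of [P].  If [t] is left of [b] and [l] above
    [r], the blocks are [{t, l}] and [{b, r}]; if [b] is left of [t] and [r]
    above [l], they are [{t, r}] and [{b, l}]; the other two orders are Q1-like.
    *)
Lemma isolated_sides_Q1_like_or_decomposable k l (P : 'M[bool]_(k, l))
    (ta ba la ra : 'I_k) (tb bb lb rb : 'I_l) :
  1 < k -> 1 < l -> weight P <= 4 ->
  ta = 0 :> nat -> ba = k.-1 :> nat -> lb = 0 :> nat -> rb = l.-1 :> nat ->
  col_isolated P ta tb -> col_isolated P ba bb ->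
  row_isolated P la lb -> row_isolated P ra rb ->
  Q1_like P \/ decomposable P.
Proof.
move=> k_gt1 l_gt1 P4 t0 b0 l0 r0 colt colb rowl rowr.
have [/existsP[[a b] /= corner]|] := boolP [exists x : 'I_k * 'I_l,
    (x \in [:: (ta, tb); (ba, bb)]) && (x \in [:: (la, lb); (ra, rb)])].
  right; case/andP: corner; rewrite !inE => ab_tb ab_lr.
  apply: (isolated_corner_decomposable (a := a) (b := b)) => //.
  - by case/orP: ab_tb => /eqP[-> _]; rewrite ?t0 ?b0 eqxx ?orbT.
  - by case/orP: ab_lr => /eqP[_ ->]; rewrite ?l0 ?r0 eqxx ?orbT.
  - by case/orP: ab_lr => /eqP[-> ->].
  - by case/orP: ab_tb => /eqP[-> ->].
rewrite negb_exists => /forallP nocorner.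
have [Pt Pb Pl Pr] : [/\ P ta tb, P ba bb, P la lb & P ra rb].
  by case: colt colb rowl rowr => [? _] [? _] [? _] [? _].
have neq_tb : tb != bb :> nat.
  apply/eqP=> eqb; have [/(congr1 val)/=] := @col_isolatedE _ _ _ _ _ (ta, tb) colb Pt eqb.
  by rewrite t0 b0; lia.
have neq_lr : la != ra :> nat.
  apply/eqP=> eqa; have [_ /(congr1 val)/=] := @row_isolatedE _ _ _ _ _ (la, lb) rowr Pl eqa.
  by rewrite l0 r0; lia.
have uniqs : uniq [:: (ta, tb); (ba, bb); (la, lb); (ra, rb)].
  have := nocorner (ta, tb); have := nocorner (ba, bb).
  rewrite /= !inE !eqxx orbT /= => /norP[bl br] /norP[tl tr].
  rewrite !negb_or bl br tl tr !andbT.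
  by rewrite !xpair_eqE negb_and neq_tb orbT /= negb_and neq_lr.
have onesP x : P x.1 x.2 -> [\/ x = (ta, tb), x = (ba, bb), x = (la, lb) | x = (ra, rb)].
  move=> Px; have /(_ x Px) : forall x, P x.1 x.2 ->
      x \in [:: (ta, tb); (ba, bb); (la, lb); (ra, rb)].
    by apply: ones_of_weight_le_size => // y; rewrite !inE => /or4P[] /eqP->.
  by rewrite !inE => /or4P[] /eqP->;
    [constructor 1 | constructor 2 | constructor 3 | constructor 4].
have onesP' a b : P a b -> [\/ a = ta /\ b = tb, a = ba /\ b = bb,
    a = la /\ b = lb | a = ra /\ b = rb].
  by move=> Pab; case: (onesP (a, b)) => // -[-> ->];
    [constructor 1 | constructor 2 | constructor 3 | constructor 4].
suff order : (tb < bb /\ ra < la) \/ (bb < tb /\ la < ra) -> Q1_like P.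
  have [lt_tb | lt_bt | eq_tb] := ltngtP tb bb; last by rewrite eq_tb eqxx in neq_tb.
    have [lt_lr | lt_rl | eq_lr] := ltngtP la ra; last by rewrite eq_lr eqxx in neq_lr.
      right; exists ra, bb; split; first by rewrite ltn_ord andbT (leq_ltn_trans _ lt_tb).
      left=> a b /onesP'[] [-> ->].
      - by rewrite t0 lt_tb (leq_ltn_trans _ lt_lr).
      - by rewrite b0 ltnn ltnNge -ltnS prednK ?ltn_ord // ltnW.
      - by rewrite lt_lr l0 (leq_ltn_trans _ lt_tb).
      - by rewrite r0 ltnn ltnNge -ltnS prednK ?ltn_ord // ltnW.
    by left; apply: order; left.
  have [lt_lr | lt_rl | eq_lr] := ltngtP la ra; last by rewrite eq_lr eqxx in neq_lr.
    by left; apply: order; right.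
  right; exists la, tb; split; first by rewrite ltn_ord andbT (leq_ltn_trans _ lt_bt).
  right=> a b /onesP'[] [-> ->].
  - by rewrite t0 leqnn (leq_ltn_trans _ lt_rl).
  - by rewrite b0 [RHS]leqNgt lt_bt ltnNge -ltnS prednK ?ltn_ord // ltnW.
  - by rewrite ltnn l0 [RHS]leqNgt (leq_ltn_trans _ lt_bt).
  - by rewrite lt_rl r0 -ltnS prednK ?ltn_ord // ltnW.
move=> order; exists (ta, tb), (ba, bb), (la, lb), (ra, rb).
have rowOnly a b : row_isolated P a b -> only_one_in P (on_row k l a) (a, b).
  move=> rowP; apply/only_one_inP; split=> [||x Px]; rewrite ?inE //=; first by case: rowP.
  by move/eqP; exact: row_isolatedE rowP Px.
have colOnly a b : col_isolated P a b -> only_one_in P (on_col k l b) (a, b).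
  move=> colP; apply/only_one_inP; split=> [||x Px]; rewrite ?inE //=; first by case: colP.
  by move/eqP; exact: col_isolatedE colP Px.
move: uniqs; rewrite /= !inE !negb_or => /and4P[/and3P[_ tl tr] /andP[bl br] lr _].
have neq_row a b x : row_isolated P a b -> P x.1 x.2 -> x != (a, b) -> x.1 != a :> nat.
  by move=> rowP Px; apply: contra_neqN => /eqP; exact: row_isolatedE rowP Px.
have neq_col a b x : col_isolated P a b -> P x.1 x.2 -> x != (a, b) -> x.2 != b :> nat.
  by move=> colP Px; apply: contra_neqN => /eqP; exact: col_isolatedE colP Px.
have side_row a b x : row_isolated P a b -> P x.1 x.2 -> x != (a, b) ->
    a == x.1 :> nat -> False.
  by move=> rowP Px neq_x /eqP eqa; move: (neq_row _ _ _ rowP Px neq_x); rewrite eqa eqxx.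
have side_col a b x : col_isolated P a b -> P x.1 x.2 -> x != (a, b) ->
    b == x.2 :> nat -> False.
  by move=> colP Px neq_x /eqP eqb; move: (neq_col _ _ _ colP Px neq_x); rewrite eqb eqxx.
split=> //; last by split; auto.
split; last by rewrite tl tr bl br lr !andbT xpair_eqE negb_and neq_tb orbT.
- apply/only_one_inP; split=> [||x]; rewrite ?inE /= ?t0 // => /onesP[]-> //=.
  + by rewrite b0 -t0 => /eqP eqb; lia.
  + by rewrite -t0 => /(side_row _ _ (ta, tb) rowl Pt tl).
  + by rewrite -t0 => /(side_row _ _ (ta, tb) rowr Pt tr).
- apply/only_one_inP; split=> [||x]; rewrite ?inE /= ?b0 // => /onesP[]-> //=.
  + by rewrite t0; lia.
  + by rewrite -b0 => /(side_row _ _ (ba, bb) rowl Pb bl).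
  + by rewrite -b0 => /(side_row _ _ (ba, bb) rowr Pb br).
- apply/only_one_inP; split=> [||x]; rewrite ?inE /= ?l0 // => /onesP[]-> //=.
  + by rewrite -l0; rewrite eq_sym in tl; move=> /(side_col _ _ (la, lb) colt Pl tl).
  + by rewrite -l0; rewrite eq_sym in bl; move=> /(side_col _ _ (la, lb) colb Pl bl).
  + by rewrite r0; lia.
- apply/only_one_inP; split=> [||x]; rewrite ?inE /= ?r0 // => /onesP[]-> //=.
  + by rewrite -r0; rewrite eq_sym in tr; move=> /(side_col _ _ (ra, rb) colt Pr tr).
  + by rewrite -r0; rewrite eq_sym in br; move=> /(side_col _ _ (ra, rb) colb Pr br).
  + by rewrite l0; lia.
Qed.

Lemma bounded_sat_Q1_like k l (P : 'M[bool]_(k, l)) :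
  0 < weight P <= 4 -> bigO1 (fun n => sat n P) ->
  [/\ k = 1, l = 1 & P = const_mx true] \/ Q1_like P.
Proof.
case/andP=> P0 P4 /(bounded_sat_sparse P0)[n [M [n_gt0 satM [i Mi] [j Mj]]]].
have satMt := saturated_trmx satM.
have [la [lb [l0 rowl]]] := empty_row_isolated_first n_gt0 satM Mi.
have [ra [rb [r0 rowr]]] := empty_row_isolated_last n_gt0 satM Mi.
have [tb [ta [t0 /row_isolated_trmx colt]]] := empty_row_isolated_first n_gt0 satMt Mj.
have [bb [ba [b0 /row_isolated_trmx colb]]] := empty_row_isolated_last n_gt0 satMt Mj.
have [l1 | l_neq1] := eqVneq l 1.
  left; have [[Ptb uniqta] [Pbb _]] := (colt, colb); subst l.
  have eqba : ba = ta by apply: uniqta; rewrite (ord1 tb) -(ord1 bb).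
  have k1 : k = 1 by rewrite -t0 -eqba b0 prednK // (leq_trans _ (ltn_ord ta)).
  subst k; split=> //; apply/matrixP=> a b; rewrite mxE.
  by rewrite (ord1 a) (ord1 b); move: Ptb; rewrite (ord1 ta) (ord1 tb).
right; have l_gt1 : 1 < l by rewrite ltn_neqAle eq_sym l_neq1 (leq_trans _ (ltn_ord lb)).
have k_gt1 : 1 < k.
  rewrite ltnNge; apply/negP=> k_le1.
  have eqa : la = ra :> nat.
    by move: (ltn_ord la) (ltn_ord ra) k_le1; clear; lia.
  have [_ /(congr1 val)/=] := @row_isolatedE _ _ _ _ _ (la, lb) rowr rowl.1 eqa.
  by rewrite l0 r0; lia.
have [//|[r [c [ltcl [blockP|blockP]]]]] :=
    isolated_sides_Q1_like_or_decomposable k_gt1 l_gt1 P4 t0 b0 l0 r0 colt colb rowl rowr.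
  by case: (block_diagonal_no_empty_row n_gt0 ltcl blockP satM Mi).
by case: (anti_block_diagonal_no_empty_row n_gt0 ltcl blockP satM Mi).
Qed.

(** * A sparse witness for Q1 *)

Lemma contains_sub m n k l (M M' : 'M[bool]_(m, n)) (P : 'M[bool]_(k, l)) :
  ones M \subset ones M' -> contains M P -> contains M' P.
Proof.
move=> /subsetP sMM' /containsP[f [g [incf incg sPM]]]; apply/containsP.
exists f, g; split=> // a b /sPM Mfg.
by have := sMM' (f a, g b); rewrite !inE; apply.
Qed.

(** A heaviest matrix that avoids [P] and contains the ones of [M] is saturated,
    and it has no 1 outside [E] times [E], where a single 1 added to [M] would
    already complete [P]. *)
Lemma sat_le_square n k l (P : 'M[bool]_(k, l)) (M : 'M[bool]_n) (E : {set 'I_n}) :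
  0 < weight P -> ~~ contains M P ->
  (forall i j, (i \notin E) || (j \notin E) -> contains (set_one M i j) P) ->
  sat n P <= #|E| ^ 2.
Proof.
move=> P0 avoidM completeM.
pose above (A : 'M[bool]_n) := ~~ contains A P && (ones M \subset ones A).
have aboveM : above M by rewrite /above avoidM subxx.
case: (@arg_maxnP _ M above (@weight n n) aboveM) => A /andP[avoidA sMA] maxA.
have [_ le_sat] := satP n P0; apply: leq_trans (le_sat A _) _.
  rewrite /saturated avoidA; apply/forallP=> i; apply/forallP=> j; apply/implyP=> Aij.
  apply: contraT => avoidAij.
  have sAAij : ones A \subset ones (set_one A i j).
    by apply/subsetP=> x; rewrite !inE set_oneE => ->; rewrite orbT.
  have /maxA : above (set_one A i j) by rewrite /above avoidAij (subset_trans sMA).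
  rewrite /= leqNgt => /negP[]; apply/proper_card/properP; split=> //.
  by exists (i, j); rewrite inE ?set_oneE ?eqxx.
have -> : #|E| ^ 2 = #|setX E E| by rewrite cardsX.
apply/subset_leq_card/subsetP=> -[i j]; rewrite !inE /= => Aij.
apply: contraR avoidA; rewrite negb_and => /completeM; apply: contains_sub.
apply/subsetP=> -[i' j']; rewrite !inE set_oneE => /orP[/eqP[-> ->] //|Mij].
by have /subsetP/(_ (i', j')) := sMA; rewrite !inE; apply.
Qed.

(** The matrix Q1 with empty rows and columns inserted inside: the rows of [t],
    [r], [l], [b] are [0 < a1 < a2 < k.-1], and the columns of [l], [t], [b],
    [r] are [0 < b1 < b2 < l.-1]. *)
Definition stretched_Q1 k l (P : 'M[bool]_(k, l)) (a1 a2 b1 b2 : nat) :=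
  [/\ 0 < a1 < a2 /\ a2 < k.-1, 0 < b1 < b2 /\ b2 < l.-1,
      forall (a : 'I_k) (b : 'I_l), P a b ->
        (a : nat, b : nat) \in [:: (0, b1); (a1, l.-1); (a2, 0); (k.-1, b2)]
    & forall (a : 'I_k) (b : 'I_l),
        (a : nat, b : nat) \in [:: (0, b1); (a1, l.-1); (a2, 0); (k.-1, b2)] -> P a b].

(** The four nonempty lines of a stretched Q1 go to the prescribed [x0], [x1],
    [x2], [x3], and the empty lines in between follow the preceding one, for
    which gaps of size [k] leave enough room. *)
Definition piecewise_shift (k a1 a2 x0 x1 x2 x3 i : nat) :=
  if i < a1 then x0 + i else if i < a2 then x1 + (i - a1)
  else if i < k.-1 then x2 + (i - a2) else x3.

Lemma piecewise_shiftP k m a1 a2 (x0 x1 x2 x3 : 'I_m) :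
  0 < a1 < a2 -> a2 < k.-1 -> x0 + k <= x1 -> x1 + k <= x2 -> x2 + k <= x3 ->
  exists f : 'I_k -> 'I_m, [/\ strictly_increasing f,
    forall a : 'I_k, a = 0 :> nat -> f a = x0,
    forall a : 'I_k, a = a1 :> nat -> f a = x1,
    forall a : 'I_k, a = a2 :> nat -> f a = x2
    & forall a : 'I_k, a = k.-1 :> nat -> f a = x3].
Proof.
move=> lta1 lta2 le1 le2 le3.
have lt_m (i : 'I_k) : piecewise_shift k a1 a2 x0 x1 x2 x3 i < m.
  rewrite /piecewise_shift; move: (ltn_ord i) (ltn_ord x3).
  by do ?[case: ifP => ?]; lia.
exists (fun i => Ordinal (lt_m i)).
split=> [i j ltij | a eqa | a eqa | a eqa | a eqa]; try apply: val_inj;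
  rewrite /= /piecewise_shift ?eqa.
- by move: (ltn_ord j); do ?[case: ifP => ?]; lia.
- by do ?[case: ifP => ?]; lia.
- by do ?[case: ifP => ?]; lia.
- by do ?[case: ifP => ?]; lia.
- by do ?[case: ifP => ?]; lia.
Qed.

Lemma contains_Q1 m n k l (M : 'M[bool]_(m, n)) (P : 'M[bool]_(k, l)) a1 a2 b1 b2
    (x0 x1 x2 x3 : 'I_m) (y0 y1 y2 y3 : 'I_n) :
  stretched_Q1 P a1 a2 b1 b2 ->
  x0 + k <= x1 -> x1 + k <= x2 -> x2 + k <= x3 ->
  y0 + l <= y1 -> y1 + l <= y2 -> y2 + l <= y3 ->
  M x0 y1 -> M x1 y3 -> M x2 y0 -> M x3 y2 -> contains M P.
Proof.
move=> [[lta1 lta2] [ltb1 ltb2] PQ _] lex1 lex2 lex3 ley1 ley2 ley3 M01 M13 M20 M32.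
have [f [incf f0 f1 f2 f3]] := piecewise_shiftP lta1 lta2 lex1 lex2 lex3.
have [g [incg g0 g1 g2 g3]] := piecewise_shiftP ltb1 ltb2 ley1 ley2 ley3.
apply/containsP; exists f, g; split=> // a b /PQ; rewrite !inE !xpair_eqE.
case/or4P=> /andP[/eqP eqa /eqP eqb].
- by rewrite (f0 a) // (g1 b).
- by rewrite (f1 a) // (g3 b).
- by rewrite (f2 a) // (g0 b).
- by rewrite (f3 a) // (g2 b).
Qed.

Lemma avoids_Q1 m n k l (M : 'M[bool]_(m, n)) (P : 'M[bool]_(k, l)) a1 a2 b1 b2 :
  stretched_Q1 P a1 a2 b1 b2 ->
  (forall (x0 x1 x2 x3 : 'I_m) (y0 y1 y2 y3 : 'I_n), x0 < x1 < x2 -> x2 < x3 ->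
     y0 < y1 < y2 -> y2 < y3 -> M x0 y1 -> M x1 y3 -> M x2 y0 -> M x3 y2 -> False) ->
  ~~ contains M P.
Proof.
move=> [[/andP[lta0 lta1] lta2] [/andP[ltb0 ltb1] ltb2] _ QP] avoidM.
apply/containsP=> -[f [g [incf incg sPM]]].
have k_gt : k.-1 < k by move: lta2; clear; lia.
have l_gt : l.-1 < l by move: ltb2; clear; lia.
pose A0 := Ordinal (leq_ltn_trans (leq0n _) k_gt).
pose A1 := Ordinal (ltn_trans lta1 (ltn_trans lta2 k_gt)).
pose A2 := Ordinal (ltn_trans lta2 k_gt).
pose A3 := Ordinal k_gt.
pose B0 := Ordinal (leq_ltn_trans (leq0n _) l_gt).
pose B1 := Ordinal (ltn_trans ltb1 (ltn_trans ltb2 l_gt)).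
pose B2 := Ordinal (ltn_trans ltb2 l_gt).
pose B3 := Ordinal l_gt.
apply: (avoidM (f A0) (f A1) (f A2) (f A3) (g B0) (g B1) (g B2) (g B3)).
- by rewrite !incf.
- by rewrite !incf.
- by rewrite !incg.
- by rewrite !incg.
- by apply/sPM/QP; rewrite !inE /= !eqxx ?orbT.
- by apply/sPM/QP; rewrite !inE /= !eqxx ?orbT.
- by apply/sPM/QP; rewrite !inE /= !eqxx ?orbT.
- by apply/sPM/QP; rewrite !inE /= !eqxx ?orbT.
Qed.

(** Positions of the ones, counting only nonempty rows and columns.  The first
    six form the matrix drawn in the introduction, whose dashed row lies between
    rows 1 and 2.  The last six are its quarter turn, placed below and to the
    right; its empty column lies between columns 7 and 8. *)
Definition witness_points : seq (nat * nat) :=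
  [:: (0, 3); (1, 1); (1, 5); (2, 0); (2, 4); (3, 2);
      (4, 7); (5, 8); (6, 6); (7, 9); (8, 7); (9, 8)].

(** A finite check over the quadruples of points playing [t], [r], [l], [b]. *)
Lemma witness_points_avoid_Q1 :
  {in witness_points & witness_points, forall p0 p1,
    {in witness_points & witness_points, forall p2 p3,
      ~~ [&& p0.1 < p1.1, p1.1 < p2.1, p2.1 < p3.1,
             p2.2 < p0.2, p0.2 < p3.2 & p3.2 < p1.2]}}.
Proof.
have : all (fun p0 => all (fun p1 => all (fun p2 => all (fun p3 =>
    ~~ [&& p0.1 < p1.1, p1.1 < p2.1, p2.1 < p3.1,
           p2.2 < p0.2, p0.2 < p3.2 & p3.2 < p1.2])
  witness_points) witness_points) witness_points) witness_points by vm_compute.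
by move=> /allP all0 p0 p1 /all0/allP all1 /all1/allP all2 p2 p3 /all2/allP; apply.
Qed.

(** The ranks [0], ..., [9] go to positions which, for [20 * D <= n], have mutual
    distance at least [D]: those up to [s] near the beginning, the others near
    the end.  The long gap after
    rank [s] holds the repeated empty row or column. *)
Definition spread n D s a := if a <= s then D * a else n.-1 - D * (9 - a).

Definition witness n D : 'M[bool]_n :=
  \matrix_(i, j) has (fun p => (i == spread n D 1 p.1 :> nat) &&
                               (j == spread n D 7 p.2 :> nat)) witness_points.

Lemma spread_gap n D s a b :
  0 < D -> 20 * D <= n -> a < b <= 9 -> spread n D s a + D <= spread n D s b.
Proof.
move=> D_gt0 le_Dn /andP[ltab le9].
have Da : D * a + D <= D * b by rewrite -mulnSr leq_mul2l ltab orbT.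
have Db : D * (9 - b) + D <= D * (9 - a) by rewrite -mulnSr leq_mul2l orbC; lia.
have Db9 : D * b <= D * 9 by rewrite leq_mul2l le9 orbT.
have Da9 : D * (9 - a) <= D * 9 by rewrite leq_mul2l leq_subr orbT.
by rewrite /spread; do ?[case: ifP => ?]; lia.
Qed.

(** Order between positions can be read off from ranks, which reduces avoidance
    to [witness_points_avoid_Q1]. *)
Lemma spread_ltW n D s a b : 0 < D -> 20 * D <= n -> a <= 9 -> b <= 9 ->
  spread n D s a < spread n D s b -> a < b.
Proof.
move=> D_gt0 le_Dn a9 b9; case: (ltngtP a b) => // [ltba | ->]; last by rewrite ltnn.
have := @spread_gap n D s b a D_gt0 le_Dn; rewrite ltba a9 => /(_ isT) gap.
by rewrite ltnNge (leq_trans (leq_addr D _) gap).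
Qed.

Lemma spread_ord n D s a : 0 < D -> 20 * D <= n -> a <= 9 ->
  exists x : 'I_n, x = spread n D s a :> nat.
Proof.
move=> D_gt0 le_Dn a9; suff ltn : spread n D s a < n by exists (Ordinal ltn).
have Da : D * a <= D * 9 by rewrite leq_mul2l a9 orbT.
by rewrite /spread; case: (leqP a s) => _; lia.
Qed.

Lemma witnessP n D (i j : 'I_n) :
  reflect (exists2 p, p \in witness_points &
             i = spread n D 1 p.1 :> nat /\ j = spread n D 7 p.2 :> nat)
          (witness n D i j).
Proof.
rewrite mxE; apply: (iffP hasP) => -[p pin].
  by case/andP=> /eqP ip /eqP jp; exists p.
by case=> -> ->; exists p; rewrite ?eqxx.
Qed.

Lemma witness_avoids n D k l (P : 'M[bool]_(k, l)) a1 a2 b1 b2 :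
  0 < D -> 20 * D <= n -> stretched_Q1 P a1 a2 b1 b2 -> ~~ contains (witness n D) P.
Proof.
move=> D_gt0 le_Dn /avoids_Q1; apply.
have le9 p : p \in witness_points -> p.1 <= 9 /\ p.2 <= 9.
  move=> pin; apply/andP.
  exact: (allP (isT : all (fun p => (p.1 <= 9) && (p.2 <= 9)) witness_points) p pin).
move=> x0 x1 x2 x3 y0 y1 y2 y3 /andP[x01 x12] x23 /andP[y01 y12] y23.
case/witnessP=> p0 p0in [x0E y1E]; case/witnessP=> p1 p1in [x1E y3E].
case/witnessP=> p2 p2in [x2E y0E]; case/witnessP=> p3 p3in [x3E y2E].
have [r0 c0] := le9 _ p0in; have [r1 c1] := le9 _ p1in.
have [r2 c2] := le9 _ p2in; have [r3 c3] := le9 _ p3in.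
have /negP[] := witness_points_avoid_Q1 p0in p1in p2in p3in.
have ltr a b : a <= 9 -> b <= 9 -> spread n D 1 a < spread n D 1 b -> a < b.
  exact: spread_ltW.
have ltc a b : a <= 9 -> b <= 9 -> spread n D 7 a < spread n D 7 b -> a < b.
  exact: spread_ltW.
apply/and5P; split; last (apply/andP; split).
- by apply: ltr; rewrite // -x0E -x1E.
- by apply: ltr; rewrite // -x1E -x2E.
- by apply: ltr; rewrite // -x2E -x3E.
- by apply: ltc; rewrite // -y0E -y1E.
- by apply: ltc; rewrite // -y1E -y2E.
- by apply: ltc; rewrite // -y2E -y3E.
Qed.

Definition border n D : {set 'I_n} :=
  [set i : 'I_n | (i < 10 * D) || (n <= i + 10 * D)].

Lemma inner_gap_above n D (i : 'I_n) s a :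
  i \notin border n D -> a <= s -> a <= 9 -> spread n D s a + D <= i.
Proof.
rewrite inE negb_or -leqNgt -ltnNge /spread => /andP[lo hi] -> a9.
have Da9 : D * a <= D * 9 by rewrite leq_mul2l a9 orbT.
by lia.
Qed.

Lemma inner_gap_below n D (i : 'I_n) s a :
  i \notin border n D -> s < a -> i + D <= spread n D s a.
Proof.
rewrite inE negb_or -leqNgt -ltnNge /spread => /andP[lo hi]; rewrite ltnNge => /negbTE->.
have Da9 : D * (9 - a) <= D * 9 by rewrite leq_mul2l leq_subr orbT.
by lia.
Qed.

Lemma card_border n D : 20 * D <= n -> #|border n D| <= 20 * D.
Proof.
move=> le_Dn; rewrite cardE -(size_map val).
have -> : 20 * D = size (iota 0 (10 * D) ++ iota (n - 10 * D) (10 * D)).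
  by rewrite size_cat !size_iota; lia.
apply: uniq_leq_size => [|_ /mapP[i iin ->]].
  by rewrite map_inj_uniq ?enum_uniq //; apply: val_inj.
move: iin; rewrite mem_enum inE mem_cat !mem_iota /=; have := ltn_ord i.
by move=> ltin /orP[?|?]; apply/orP; [left | right]; lia.
Qed.

(** The new 1 plays [l] or [r] in an inner row, and [t] or [b] in an inner
    column.  The two choices overlap enough because the gap [D] between the ranks
    2 and 3 of the columns (6 and 7 of the rows) is at least [2 * (k + l)]: each
    place is far enough from one end of this gap. *)
Lemma witness_completes n D k l (P : 'M[bool]_(k, l)) a1 a2 b1 b2 (i j : 'I_n) :
  0 < D -> 20 * D <= n -> 2 * (k + l) <= D -> stretched_Q1 P a1 a2 b1 b2 ->
  (i \notin border n D) || (j \notin border n D) ->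
  contains (set_one (witness n D) i j) P.
Proof.
move=> D_gt0 le_Dn le_klD Q1P.
have gapk x y : x + D <= y -> x + k <= y.
  by apply: leq_trans; rewrite leq_add2l; move: le_klD; clear; lia.
have gapl x y : x + D <= y -> x + l <= y.
  by apply: leq_trans; rewrite leq_add2l; move: le_klD; clear; lia.
have row a : a <= 9 -> exists x : 'I_n, x = spread n D 1 a :> nat by apply: spread_ord.
have col b : b <= 9 -> exists y : 'I_n, y = spread n D 7 b :> nat by apply: spread_ord.
have new : set_one (witness n D) i j i j by rewrite set_oneE eqxx.
have old (x y : 'I_n) a b : (a, b) \in witness_points ->
    x = spread n D 1 a :> nat -> y = spread n D 7 b :> nat ->
    set_one (witness n D) i j x y.
  move=> abin xE yE; rewrite set_oneE; apply/orP; right.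
  by apply/witnessP; exists (a, b).
have split_at m x y z : m <= k + l -> x + D <= y -> z + m <= y \/ x + m <= z.
  move: le_klD; clear => le_klD lem lexy.
  by have [?|?] := leqP (z + m) y; [left | right; lia].
case/orP=> inner.
  have gap : spread n D 7 2 + D <= spread n D 7 3 by apply: spread_gap.
  have [x0 x0E] := row 0 isT; have [x1 x1E] := row 1 isT.
  have [x2 x2E] := row 2 isT; have [x3 x3E] := row 3 isT.
  have [y0 y0E] := col 0 isT; have [y1 y1E] := col 1 isT; have [y2 y2E] := col 2 isT.
  have [y3 y3E] := col 3 isT; have [y4 y4E] := col 4 isT; have [y5 y5E] := col 5 isT.
  have [lej | gej] := split_at l _ _ j (leq_addl _ _) gap.
    apply: (@contains_Q1 _ _ _ _ _ _ a1 a2 b1 b2 x0 x1 i x2 j y3 y4 y5) => //.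
    + by rewrite x0E x1E gapk // spread_gap.
    + by rewrite x1E gapk // (inner_gap_above inner).
    + by rewrite x2E gapk // (inner_gap_below inner).
    + by rewrite y3E.
    + by rewrite y3E y4E gapl // spread_gap.
    + by rewrite y4E y5E gapl // spread_gap.
    + exact: old x0E y3E.
    + exact: old x1E y5E.
    + exact: old x2E y4E.
  apply: (@contains_Q1 _ _ _ _ _ _ a1 a2 b1 b2 x1 i x2 x3 y0 y1 y2 j) => //.
  + by rewrite x1E gapk // (inner_gap_above inner).
  + by rewrite x2E gapk // (inner_gap_below inner).
  + by rewrite x2E x3E gapk // spread_gap.
  + by rewrite y0E y1E gapl // spread_gap.
  + by rewrite y1E y2E gapl // spread_gap.
  + by rewrite y2E.
  + exact: old x1E y1E.
  + exact: old x2E y0E.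
  + exact: old x3E y2E.
have gap : spread n D 1 6 + D <= spread n D 1 7 by apply: spread_gap.
have [x4 x4E] := row 4 isT; have [x5 x5E] := row 5 isT; have [x6 x6E] := row 6 isT.
have [x7 x7E] := row 7 isT; have [x8 x8E] := row 8 isT; have [x9 x9E] := row 9 isT.
have [y6 y6E] := col 6 isT; have [y7 y7E] := col 7 isT.
have [y8 y8E] := col 8 isT; have [y9 y9E] := col 9 isT.
have [lei | gei] := split_at k _ _ i (leq_addr _ _) gap.
  apply: (@contains_Q1 _ _ _ _ _ _ a1 a2 b1 b2 i x7 x8 x9 y7 j y8 y9) => //.
  + by rewrite x7E.
  + by rewrite x7E x8E gapk // spread_gap.
  + by rewrite x8E x9E gapk // spread_gap.
  + by rewrite y7E gapl // (inner_gap_above inner).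
  + by rewrite y8E gapl // (inner_gap_below inner).
  + by rewrite y8E y9E gapl // spread_gap.
  + exact: old x7E y9E.
  + exact: old x8E y7E.
  + exact: old x9E y8E.
apply: (@contains_Q1 _ _ _ _ _ _ a1 a2 b1 b2 x4 x5 x6 i y6 y7 j y8) => //.
+ by rewrite x4E x5E gapk // spread_gap.
+ by rewrite x5E x6E gapk // spread_gap.
+ by rewrite x6E.
+ by rewrite y6E y7E gapl // spread_gap.
+ by rewrite y7E gapl // (inner_gap_above inner).
+ by rewrite y8E gapl // (inner_gap_below inner).
+ exact: old x4E y7E.
+ exact: old x5E y8E.
+ exact: old x6E y6E.
Qed.

(** All ones added to the witness lie in the border rows and columns, whose
    number depends only on [D]. *)
Lemma stretched_Q1_bounded_sat k l (P : 'M[bool]_(k, l)) a1 a2 b1 b2 :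
  stretched_Q1 P a1 a2 b1 b2 -> bigO1 (fun n => sat n P).
Proof.
move=> Q1P; pose D := 2 * (k + l).
have D_gt0 : 0 < D by case: Q1P => [[_ ltk] _ _ _]; rewrite /D; move: ltk; clear; lia.
exists ((20 * D) ^ 2), (20 * D) => n le_Dn.
apply: leq_trans (_ : #|border n D| ^ 2 <= _); last by rewrite leq_exp2r // card_border.
apply: (@sat_le_square _ _ _ _ (witness n D)).
- case: Q1P => [[/andP[a1_gt0 lta1] lta2] [/andP[b1_gt0 ltb1] ltb2] _ QP].
  have k_gt0 : 0 < k by move: lta2; clear; lia.
  have ltb : b1 < l by move: ltb1 ltb2; clear; lia.
  apply/card_gt0P; exists (Ordinal k_gt0, Ordinal ltb).
  by rewrite inE; apply: QP; rewrite inE eqxx.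
- exact: witness_avoids D_gt0 le_Dn Q1P.
- by move=> i j; apply: witness_completes D_gt0 le_Dn (leqnn _) Q1P.
Qed.

Lemma unit_bounded_sat : bigO1 (fun n => sat n (const_mx true : 'M[bool]_1)).
Proof.
exists 0, 0 => n _; apply: leq_trans (_ : #|(set0 : {set 'I_n})| ^ 2 <= 0).
  2: by rewrite cards0.
apply: (@sat_le_square _ _ _ _ (const_mx false) set0) => [||i j _].
- by apply/card_gt0P; exists (ord0, ord0); rewrite inE mxE.
- by apply/containsP=> -[f [g [_ _ /(_ ord0 ord0)]]]; rewrite !mxE => /(_ isT).
apply/containsP; exists (fun=> i), (fun=> j).
by split=> [a b|a b|a b _]; rewrite ?set_oneE ?eqxx // !ord1.
Qed.

(** Four distinct ones exhaust the weight.  The two cases of the third clause are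
    exchanged by the mirror image, which also exchanges [l] and [r]. *)
Lemma Q1_like_stretched_Q1 k l (P : 'M[bool]_(k, l)) :
  weight P <= 4 -> Q1_like P ->
  exists a1 a2 b1 b2, stretched_Q1 P a1 a2 b1 b2 \/ stretched_Q1 (mirror P) a1 a2 b1 b2.
Proof.
move=> P4 [[ta tb] [[ba bb] [[la lb] [[ra rb] [[Ht Hb Hl Hr uniqs] [Ct Cb Rl Rr] order]]]]].
case/only_one_inP: Ht => /= Pt; rewrite inE /= => /eqP t0 Ht.
case/only_one_inP: Hb => /= Pb; rewrite inE /= => /eqP b0 Hb.
case/only_one_inP: Hl => /= Pl; rewrite inE /= => /eqP l0 Hl.
case/only_one_inP: Hr => /= Pr; rewrite inE /= => /eqP r0 Hr.
have onesP x : P x.1 x.2 -> x \in [:: (ta, tb); (ba, bb); (la, lb); (ra, rb)].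
  apply: ones_of_weight_le_size => // y.
  by rewrite !inE => /or4P[] /eqP->.
move: uniqs; rewrite /= !inE !negb_or => /and4P[/and3P[_ tl tr] /andP[bl br] lr _].
have Pval (a : 'I_k) (b : 'I_l) a' b' : P a' b' -> a = a' :> nat -> b = b' :> nat -> P a b.
  by move=> Pab /val_inj-> /val_inj->.
have rev_val (b b' : 'I_l) : b = b' :> nat -> rev_ord b = rev_ord b' :> nat.
  by move=> /val_inj->.
have la_gt0 : 0 < la.
  rewrite lt0n; apply: contra_neqN tl => /eqP la0.
  by rewrite (Ht (la, lb)) // inE /= la0.
have ra_gt0 : 0 < ra.
  rewrite lt0n; apply: contra_neqN tr => /eqP ra0.
  by rewrite (Ht (ra, rb)) // inE /= ra0.
have la_ltk : la < k.-1.
  rewrite ord_lt_last; apply: contra_neqN bl => /eqP la0.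
  by rewrite (Hb (la, lb)) // inE /= la0.
have ra_ltk : ra < k.-1.
  rewrite ord_lt_last; apply: contra_neqN br => /eqP ra0.
  by rewrite (Hb (ra, rb)) // inE /= ra0.
have tb_gt0 : 0 < tb.
  rewrite lt0n; apply: contra_neqN tl => /eqP tb0.
  by rewrite (Hl (ta, tb)) // inE /= tb0.
have bb_gt0 : 0 < bb.
  rewrite lt0n; apply: contra_neqN bl => /eqP bb0.
  by rewrite (Hl (ba, bb)) // inE /= bb0.
have tb_ltl : tb < l.-1.
  rewrite ord_lt_last; apply: contra_neqN tr => /eqP tb0.
  by rewrite (Hr (ta, tb)) // inE /= tb0.
have bb_ltl : bb < l.-1.
  rewrite ord_lt_last; apply: contra_neqN br => /eqP bb0.
  by rewrite (Hr (ba, bb)) // inE /= bb0.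
case: order => /= -[order_tb order_lr].
  exists ra, la, tb, bb; left; split.
  - by rewrite ra_gt0 order_lr.
  - by rewrite tb_gt0 order_tb.
  - move=> a b /(onesP (_, _)); rewrite !inE => /or4P[] /eqP[-> ->];
      by rewrite ?t0 ?b0 ?l0 ?r0 !eqxx ?orbT.
  - move=> a b; rewrite !inE !xpair_eqE => /or4P[] /andP[/eqP eqa /eqP eqb].
    + by apply: (Pval _ _ ta tb); rewrite ?eqa ?eqb.
    + by apply: (Pval _ _ ra rb); rewrite ?eqa ?eqb.
    + by apply: (Pval _ _ la lb); rewrite ?eqa ?eqb.
    + by apply: (Pval _ _ ba bb); rewrite ?eqa ?eqb.
have rev_lt (b b' : 'I_l) : b < b' -> rev_ord b' < rev_ord b.
  by move: (ltn_ord b'); clear=> /= ltb' ltbb'; lia.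
have rev_gt0 (b : 'I_l) : b < l.-1 -> 0 < rev_ord b by clear => /=; lia.
have rev_ltl (b : 'I_l) : 0 < b -> rev_ord b < l.-1.
  by have := ltn_ord b; clear => /=; lia.
have rev0 (b : 'I_l) : b = 0 :> nat -> rev_ord b = l.-1 :> nat.
  by clear => /= ->; rewrite subn1.
have revl (b : 'I_l) : b = l.-1 :> nat -> rev_ord b = 0 :> nat.
  by have := ltn_ord b; clear => /=; lia.
exists la, ra, (rev_ord tb), (rev_ord bb); right; split.
- by rewrite la_gt0 order_lr.
- by rewrite rev_gt0 // rev_lt // rev_ltl.
- move=> a b; rewrite mirrorE => /(onesP (_, _)); rewrite !inE -{5 6 7 8}(rev_ordK b).
  by case/or4P=> /eqP[-> ->]; rewrite ?t0 ?b0 ?(revl _ r0) ?(rev0 _ l0) !eqxx ?orbT.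
- move=> a b; rewrite mirrorE !inE !xpair_eqE => /or4P[] /andP[/eqP eqa /eqP eqb].
  + by apply: (Pval _ _ ta tb); rewrite ?eqa // -(rev_ordK tb); apply: rev_val.
  + by apply: (Pval _ _ la lb); rewrite ?eqa // l0; apply: revl.
  + by apply: (Pval _ _ ra rb); rewrite ?eqa // r0; apply: rev0.
  + by apply: (Pval _ _ ba bb); rewrite ?eqa // -(rev_ordK bb); apply: rev_val.
Qed.

Theorem theorem9p2 (k l : nat) (P : 'M[bool]_(k, l)) (hP : 1 <= weight P <= 4) :
  bigO1 (fun n => sat n P) <->
  ([/\ k = 1, l = 1 & P = const_mx true] \/ Q1_like P).
Proof.
split; first exact: bounded_sat_Q1_like.
case=> [[k1 l1 ->] | Q1P]; first by subst k l; apply: unit_bounded_sat.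
have /andP[P0 P4] := hP.
have [a1 [a2 [b1 [b2 [] /stretched_Q1_bounded_sat//]]]] :=
    Q1_like_stretched_Q1 P4 Q1P.
case=> C [N leC]; exists C, N => n /leC; apply: leq_trans.
exact: leq_sat_mirror.
Qed.
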